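(* For every finite set $S\subseteq\mathbb{N}_{>1}$ there exists $m$ such that $\operatorname{C}(m)\wedge\neg\operatorname{R}_S(m)$.
   Context: $\mathbb{N}_{>1}$ is the set of integers greater than $1$; logic is intuitionistic. $\operatorname{C}(n)$ (composite) means $\exists a,b\le n\,(a>1\wedge b>1\wedge ab=n)$. For a finite set $S\subseteq\mathbb{N}_{>1}$, the composite catcher generated by $S$ is $\operatorname{R}_S(n)\iff\exists d\in S\,\exists b>1\,(db=n)$. *)

(* Defs.v *)
From mathcomp Require Import all_boot.
From mathcomp Require Import finmap.

Set Implicit Arguments.
Unset Strict Implicit.
Unset Printing Implicit Defensive.

Definition composite (n : nat) : Prop :=
  exists a b : nat, [/\ a <= n, b <= n & [/\ 1 < a, 1 < b & a * b = n]].

(* The requirement that the elements of S exceed 1 is not part of this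
   definition: it is stated as a hypothesis wherever S is quantified. *)
Definition composite_catcher (S : {fset nat}) (n : nat) : Prop :=
  exists d b : nat, [/\ d \in S, 1 < b & d * b = n].

(* Main.v *)
Require Import Defs.
From mathcomp Require Import all_boot finmap.

(** Euclid's infinitude of primes gives a prime [p] exceeding every element of
    [S], and [m = p * p] escapes the catcher: an integer [d] with [1 < d < p]
    is coprime to [p], hence to [p * p], so it cannot divide [p * p]. The
    witness is computed from [S], so the argument is constructive. *)

Lemma fset_prime_above (S : {fset nat}) :
  exists2 p : nat, prime p & forall d : nat, d \in S -> d < p.
Proof.
have [p lt_max_p pr_p] := prime_above (\max_(d <- S) d).
exists p => // d dS; apply: leq_ltn_trans lt_max_p.
exact: leq_bigmax_seq.
Qed.

Lemma prime_square_Ndvd (p d : nat) :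
  prime p -> 1 < d -> d < p -> ~~ (d %| p * p).
Proof.
move=> pr_p d_gt1 lt_dp.
have co_dp : coprime d p.
  by rewrite coprime_sym prime_coprime // gtnNdvd // ltnW.
apply/negP => d_dvd; have: coprime d (p * p) by rewrite coprimeMr co_dp.
by rewrite /coprime (gcdn_idPl d_dvd) gtn_eqF.
Qed.

Theorem theorem4p3p3 (S : {fset nat}) (hS : forall d : nat, d \in S -> 1 < d) :
  exists m : nat, composite m /\ ~ composite_catcher S m.
Proof.
have [p pr_p ltSp] := fset_prime_above S.
have p_gt1 := prime_gt1 pr_p; have p_gt0 := prime_gt0 pr_p.
exists (p * p); split.
  by exists p, p; rewrite leq_pmulr.
case=> d [b [dS _ def_pp]].
have /negP[] := prime_square_Ndvd p d pr_p (hS d dS) (ltSp d dS).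
by rewrite -def_pp dvdn_mulr.
Qed.
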